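(* Let $R, S$ be finite posets. The following are equivalent: (1) $R \sqsubseteq_G S$; (2) $\# \mathcal{S}(P,R) \leq \# \mathcal{S}(P,S)$ for all finite posets $P$; (3) $\# \mathcal{S}(Q,R) \leq \# \mathcal{S}(Q,S)$ for all finite connected posets $Q$.
   Context: $\mathfrak{P}$ is the class of all finite posets and $\mathfrak{P}_r$ is a fixed representation system of the isomorphism classes in $\mathfrak{P}$ (one poset per isomorphism class). $\mathcal{H}(P,Q)$ is the set of order homomorphisms $\xi : P \to Q$, i.e. maps with $x \leq y \Rightarrow \xi(x) \leq \xi(y)$. A homomorphism $\xi$ is strict if $x < y \Rightarrow \xi(x) < \xi(y)$; $\mathcal{S}(P,Q)$ is the set of strict homomorphisms from $P$ to $Q$. For $A \subseteq P$ and $x,y \in A$, $x$ and $y$ are connected in $A$ if there are $z_0, \ldots, z_L \in A$, $L \geq 0$, with $x = z_0$, $y = z_L$ and, for each $\ell = 1, \ldots, L$, $z_{\ell-1} < z_\ell$ or $z_{\ell-1} > z_\ell$. $\gamma_A(x)$ denotes the set of $y \in A$ connected with $x$ in $A$. A poset $P$ is connected if $\gamma_P(x) = P$ for some $x \in P$. For a homomorphism $\xi$ defined on $P$ and $x \in P$, $G_\xi(x) := \gamma_{\xi^{-1}(\{\xi(x)\})}(x)$. A Hom-scheme from $R$ to $S$ is a family $\rho = (\rho_P)_{P \in \mathfrak{P}_r}$ of maps $\rho_P : \mathcal{H}(P,R) \to \mathcal{H}(P,S)$. It is strong if every $\rho_P$ is injective. It is a G-scheme if $G_{\rho_P(\xi)}(x)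 = G_\xi(x)$ for all $P \in \mathfrak{P}_r$, $\xi \in \mathcal{H}(P,R)$, $x \in P$. We write $R \sqsubseteq_G S$ iff a strong G-scheme from $R$ to $S$ exists. *)

(* Defs.v *)
From mathcomp Require Import all_boot all_order.

Set Implicit Arguments.
Unset Strict Implicit.
Unset Printing Implicit Defensive.

Import Order.TTheory.
Local Open Scope order_scope.

(* A finite poset is a [finPOrderType d]; the empty poset is allowed.  The
   display [d] only steers notations, so it is the same for all posets. *)

Section Homs.
Variables (d : Order.disp_t) (P Q : finPOrderType d).

Definition order_hom (f : {ffun P -> Q}) : bool :=
  [forall x, forall y, (x <= y) ==> (f x <= f y)].

Definition hom := {f : {ffun P -> Q} | order_hom f}.

Definition strict (xi : hom) : bool :=
  [forall x, forall y, (x < y) ==> (val xi x < val xi y)].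

Definition strict_homs : {set hom} := [set xi | strict xi].

Definition poset_iso : Prop :=
  exists f : P -> Q, bijective f /\ {mono f : x y / x <= y}.

End Homs.

Section Connectivity.
Variables (d : Order.disp_t) (P : finPOrderType d).

Definition step_in (A : {set P}) : rel P :=
  [rel x y | [&& x \in A, y \in A & (x < y) || (y < x)]].

(* [connect] is the existence of a path, possibly of length 0; only x \in A
   is meaningful. *)
Definition gamma (A : {set P}) (x : P) : {set P} :=
  [set y in A | connect (step_in A) x y].

Definition connected_poset : Prop := exists x : P, gamma [set: P] x = [set: P].

End Connectivity.

Definition G (d : Order.disp_t) (P Q : finPOrderType d) (xi : hom P Q) (x : P) :
    {set P} :=
  gamma (val xi @^-1: [set val xi x]) x.

Section Schemes.
Variables (d : Order.disp_t) (I : Type) (Pr : I -> finPOrderType d).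

(* The family Pr contains exactly one member of each isomorphism class. *)
Definition representation_system : Prop :=
  forall P : finPOrderType d, exists! i : I, poset_iso P (Pr i).

Variables (R S : finPOrderType d).

Definition hom_scheme := forall i : I, hom (Pr i) R -> hom (Pr i) S.

Definition strong (rho : hom_scheme) : Prop := forall i : I, injective (rho i).

Definition G_scheme (rho : hom_scheme) : Prop :=
  forall (i : I) (xi : hom (Pr i) R) (x : Pr i), G (rho i xi) x = G xi x.

Definition sqsubseteq_G : Prop :=
  exists rho : hom_scheme, strong rho /\ G_scheme rho.

End Schemes.

(* Main.v *)
Require Import Defs.
From HB Require Import structures.
From mathcomp Require Import all_boot all_order.

(** A homomorphism [xi] cuts its domain [P] into the connected pieces of its
    level sets, and [G xi] records exactly this partition.  Everything rests on
    two observations.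

    Contract every piece to a point, ordering the points by the transitive
    closure of the relation induced by [P].  The result is again a poset: along
    a chain of comparabilities [xi] can only grow, and if it returns to its
    starting value it never left the level set, hence never left the piece
    ([contraction_le_mono]).  For the same reason the homomorphisms from [P] to
    a poset [T] that have the same partition as [xi] are the strict
    homomorphisms from the contraction to [T], composed with the projection
    ([card_strict_contraction]).  So if strict homomorphisms into [R] are never
    more numerous than those into [S], then for every partition there are at
    most as many homomorphisms into [R] as into [S] inducing it; injections
    chosen separately for each partition together form a strong G-scheme
    ([G_preserving_injection]).  Conversely, the strict homomorphisms are those
    whose partition is into singletons ([strict_GP]), so the maps of a strong
    G-scheme send strict homomorphisms injectively to strict homomorphisms; an
    arbitrary poset is handled by its isomorphic copy in the representation
    system.

    A strict homomorphism from a disjoint union is a pair of strict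
    homomorphisms from the parts ([card_strict_homs_split]), so the counts for
    arbitrary posets are products of the counts for connected ones, and
    inequalities between natural numbers can be multiplied
    ([card_strict_homs_connected]). *)

Set Implicit Arguments.
Unset Strict Implicit.
Unset Printing Implicit Defensive.

Import Order.TTheory.

(** * Injections over a common base *)

Section FibrewiseInjection.
Variables (A B : finType) (K : eqType) (f : A -> K) (g : B -> K).

(** List the two fibres over each [k] and match the entries of equal rank.
    The map [g] then recovers the fibre of [h a], which is why the separate
    injections do not collide. *)
Lemma fibrewise_injection :
  (forall k, #|[set a | f a == k]| <= #|[set b | g b == k]|) ->
  exists h : A -> B, injective h /\ forall a, g (h a) = f a.
Proof.
move=> le_fg; pose fibre_f k := enum [set a | f a == k].
pose fibre_g k := enum [set b | g b == k].
have lt_idx a : index a (fibre_f (f a)) < size (fibre_g (f a)).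
  apply: leq_trans (_ : size (fibre_f (f a)) <= _); last by rewrite -!cardE.
  by rewrite index_mem mem_enum inE.
(* An element of [B] is needed as a default for [nth]; since the fibre over
   [f a] is nonempty it provides one, and the choice does not affect [h a]. *)
have pick_h a : {b | b = nth b (fibre_g (f a)) (index a (fibre_f (f a)))}.
  case E: (fibre_g (f a)) (lt_idx a) => [//|b0 s] lt_s.
  exists (nth b0 (b0 :: s) (index a (fibre_f (f a)))).
  exact: set_nth_default.
pose h a := sval (pick_h a).
have hE a b0 : h a = nth b0 (fibre_g (f a)) (index a (fibre_f (f a))).
  by rewrite {1}/h (svalP (pick_h a)); apply: set_nth_default.
have gh a : g (h a) = f a.
  have := mem_nth (h a) (lt_idx a).
  by rewrite -hE mem_enum inE => /eqP.
exists h; split=> // a a' eq_h.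
have eq_f : f a = f a' by rewrite -!gh eq_h.
move/eqP: eq_h; rewrite (hE a (h a)) (hE a' (h a)) -eq_f.
rewrite nth_uniq ?enum_uniq //; last by rewrite eq_f.
move/eqP => eq_i.
have in_f x : f x = f a -> x \in fibre_f (f a).
  by move=> fx; rewrite mem_enum inE fx.
by rewrite -(nth_index a (in_f a erefl)) eq_i nth_index ?in_f.
Qed.

End FibrewiseInjection.

Local Open Scope order_scope.

(** * Level sets of homomorphisms and strictness *)

Section Homomorphisms.
Variables (d : Order.disp_t) (P Q : finPOrderType d).
Implicit Types xi eta : hom P Q.

Lemma hom_mono xi : {homo val xi : x y / x <= y}.
Proof.
by move=> x y; move/forallP: (valP xi) => /(_ x)/forallP/(_ y)/implyP.
Qed.

Lemma order_hom_finfun (f : P -> Q) :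
  {homo f : x y / x <= y} -> order_hom [ffun x => f x].
Proof.
by move=> f_mono; apply/forallP=> x; apply/forallP=> y;
   apply/implyP=> le_xy; rewrite !ffunE f_mono.
Qed.

Definition mk_hom (f : P -> Q) (f_mono : {homo f : x y / x <= y}) : hom P Q :=
  exist _ [ffun x => f x] (order_hom_finfun f_mono).

Lemma mk_homE f (f_mono : {homo f : x y / x <= y}) x :
  val (mk_hom f_mono) x = f x.
Proof. by rewrite ffunE. Qed.

Lemma hom_ext xi eta : val xi =1 val eta -> xi = eta.
Proof. by move=> eq_xe; apply/val_inj/ffunP. Qed.

Lemma strictP xi :
  reflect {homo val xi : x y / x < y} (xi \in strict_homs P Q).
Proof.
rewrite inE; apply: (iffP idP) => [str x y|str].
  by move/forallP: str => /(_ x)/forallP/(_ y)/implyP.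
by apply/forallP=> x; apply/forallP=> y; apply/implyP; apply: str.
Qed.

(** Weak comparability replaces the strict one of [step_in], and the level set
    is not fixed in advance: this turns the family of all [G xi x] into the
    classes of a single equivalence relation on the whole of [P]. *)
Definition level_step xi : rel P :=
  [rel x y | (val xi x == val xi y) && (x >=< y)].

Definition level_connect xi : rel P := connect (level_step xi).

Lemma level_connect_sym xi : connect_sym (level_step xi).
Proof.
apply: sym_connect_sym => x y /=.
by rewrite /level_step /= eq_sym comparable_sym.
Qed.

Lemma level_connect_val xi x y : level_connect xi x y -> val xi x = val xi y.
Proof.
case/connectP=> p; elim: p x => [|z p IHp] x /=; first by move=> _ ->.
by case/andP=> /andP[/eqP-> _]; apply: IHp.
Qed.

Lemma level_connect1 xi x y :
  val xi x = val xi y -> x >=< y -> level_connect xi x y.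
Proof.
by move=> xi_xy cmp_xy; apply: connect1; rewrite /level_step /= xi_xy eqxx.
Qed.

Lemma mem_G xi x y : (y \in G xi x) = level_connect xi x y.
Proof.
rewrite /G /gamma; set A := _ @^-1: _.
have memA z : (z \in A) = (val xi z == val xi x) by rewrite inE in_set1.
rewrite inE; apply/andP/idP => [[_]|].
  apply: connect_sub => u v /= /and3P[]; rewrite !memA => /eqP xi_u /eqP xi_v.
  move=> cmp_uv; apply: level_connect1; first by rewrite xi_u xi_v.
  by rewrite /Order.comparable; case/orP: cmp_uv => /ltW->; rewrite ?orbT.
move=> conn; split; first by rewrite memA -(level_connect_val conn).
case/connectP: conn => p e_p ->.
suff: forall u, val xi u = val xi x -> path (level_step xi) u p ->
    connect (step_in A) u (last u p) by apply.
elim: p {e_p} => [|z p IHp] u xi_u /=; first by move=> _; apply: connect0.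
case/andP=> /andP[/eqP xi_uz cmp_uz] e_p.
have{IHp e_p} := IHp z (etrans (esym xi_uz) xi_u) e_p.
apply: connect_trans; have [->|ne_uz] := eqVneq u z; first exact: connect0.
apply: connect1; rewrite /step_in /= !memA -xi_uz xi_u eqxx /=.
by rewrite !lt_neqAle ne_uz eq_sym ne_uz.
Qed.

(** Strictness can be read off the partition alone, so every map that
    preserves the partition preserves strictness.  Two comparable points on one
    level would lie in one piece, and a piece with two points contains two
    comparable points on one level. *)
Lemma strict_GP xi :
  reflect (forall x, G xi x = [set x]) (xi \in strict_homs P Q).
Proof.
apply: (iffP (strictP xi)) => [xi_str x|G1 x y lt_xy].
  apply/setP=> y; rewrite mem_G in_set1; apply/idP/eqP=> [|->]; last first.
    exact: connect0.
  case/connectP=> p; elim: p x => [|z p IHp] x //= /andP[/andP[/eqP xi_xz]].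
  rewrite comparable_sym => cmp.
  suff ->: x = z by apply: IHp.
  have /orP := cmp; rewrite !le_eqVlt => -[] /predU1P[//|/xi_str];
    by rewrite xi_xz ltxx.
rewrite lt_neqAle hom_mono ?ltW // andbT; apply/eqP=> xi_xy.
have: y \in G xi x.
  by rewrite mem_G level_connect1 // le_comparable ?ltW.
by rewrite G1 in_set1 => /eqP eq_yx; rewrite eq_yx ltxx in lt_xy.
Qed.

End Homomorphisms.

(** * Precomposition with monotone maps *)

Section Precomposition.
Variables (d : Order.disp_t) (P Q T : finPOrderType d).
Variables (f : P -> Q) (f_mono : {homo f : x y / x <= y}).

Lemma precomp_mono (xi : hom Q T) : {homo val xi \o f : x y / x <= y}.
Proof. by move=> x y le_xy /=; apply/hom_mono/f_mono. Qed.

Definition precomp (xi : hom Q T) : hom P T := mk_hom (precomp_mono xi).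

Lemma precompE xi x : val (precomp xi) x = val xi (f x).
Proof. exact: mk_homE. Qed.

Lemma precomp_inj g : cancel g f -> injective precomp.
Proof.
move=> gK xi eta eq_xe; apply: hom_ext => q.
by rewrite -(gK q) -!precompE eq_xe.
Qed.

End Precomposition.

Lemma card_strict_homs_iso (d : Order.disp_t) (P Q T : finPOrderType d) :
  poset_iso P Q -> (#|strict_homs P T| = #|strict_homs Q T|)%N.
Proof.
case=> f [[g fK gK] f_mono].
have f_homo : {homo f : x y / x <= y} by move=> x y; rewrite f_mono.
have g_homo : {homo g : x y / x <= y} by move=> x y; rewrite -f_mono !gK.
have f_lt := leW_mono f_mono.
rewrite -(card_imset (strict_homs Q T) (precomp_inj (f_mono := f_homo) gK)).
congr #|pred_of_set _|; apply/setP=> xi.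
apply/strictP/imsetP=> [xi_str|[eta /strictP eta_str ->] x y lt_xy].
  exists (precomp g_homo xi); last first.
    by apply: hom_ext => x; rewrite !precompE fK.
  by apply/strictP=> x y lt_xy; rewrite !precompE xi_str // -f_lt !gK.
by rewrite !precompE eta_str ?f_lt.
Qed.

(** * Contracting the pieces of a homomorphism *)

Section Contraction.
Variables (d : Order.disp_t) (P R : finPOrderType d) (xi0 : hom P R).

Definition contraction_step : rel P :=
  [rel x y | (x <= y) || level_connect xi0 x y].

Definition contraction_le : rel P := connect contraction_step.

Lemma le_contraction_le x y : x <= y -> contraction_le x y.
Proof.
by move=> le_xy; apply: connect1; rewrite /contraction_step /= le_xy.
Qed.

Lemma level_contraction_le x y : level_connect xi0 x y -> contraction_le x y.
Proof.
by move=> lv_xy; apply: connect1; rewrite /contraction_step /= lv_xy orbT.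
Qed.

(** The key to both antisymmetry and strictness: a chain of steps on which [xi]
    takes equal values at both ends stays on one level, since [xi] is
    nondecreasing along it, and its comparabilities then connect the endpoints
    inside a piece.  It is stated for any [xi] with the partition of [xi0], as
    such [xi] are what the contraction has to account for. *)
Lemma contraction_le_mono (T : finPOrderType d) (xi : hom P T) x y :
    level_connect xi =2 level_connect xi0 -> contraction_le x y ->
  val xi x <= val xi y /\ (val xi x = val xi y -> level_connect xi0 x y).
Proof.
move=> eq_lv /connectP[p e_p ->]; elim: p x e_p => [|z p IHp] x /=.
  by move=> _; split=> // _; apply: connect0.
case/andP=> xz /IHp[le_zy lv_zy].
have [le_xz lv_xz] : val xi x <= val xi z /\
    (val xi x = val xi z -> level_connect xi0 x z).
  case/orP: xz => [le_xz|lv_xz]; last first.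
    split=> //.
    by rewrite (level_connect_val (_ : level_connect xi x z)) ?eq_lv.
  split=> [|eq_xz]; first exact: hom_mono.
  by rewrite -eq_lv level_connect1 // le_comparable.
split=> [|eq_xy]; first exact: le_trans le_zy.
have eq_xz : val xi x = val xi z by apply: le_anti; rewrite le_xz eq_xy.
by apply: connect_trans (lv_xz eq_xz) (lv_zy _); rewrite -eq_xz.
Qed.

(** Pieces are encoded by their roots so that [val] is a section of the
    projection: homomorphisms descend to the contraction by restriction. *)
Definition contraction := {x : P | x \in roots (level_step xi0)}.

HB.instance Definition _ := SubFinite.on contraction.

Definition contraction_ord : rel contraction :=
  fun A B => contraction_le (val A) (val B).

Lemma contraction_ext (A B : contraction) :
  level_connect xi0 (val A) (val B) -> A = B.
Proof.
move=> lv_AB; apply/val_inj.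
have root_val (C : contraction) : root (level_step xi0) (val C) = val C.
  exact: (eqP (svalP C)).
by rewrite -root_val -(root_val B); apply/(rootP (level_connect_sym xi0)).
Qed.

Lemma contraction_ord_refl : reflexive contraction_ord.
Proof. by move=> A; apply: connect0. Qed.

Lemma contraction_ord_trans : transitive contraction_ord.
Proof. by move=> B A C; apply: connect_trans. Qed.

Lemma contraction_ord_anti : antisymmetric contraction_ord.
Proof.
move=> A B /andP[le_AB le_BA]; apply: contraction_ext.
have [xi_AB ->] := contraction_le_mono (fun _ _ => erefl) le_AB => //.
have [xi_BA _] := contraction_le_mono (fun _ _ => erefl) le_BA.
by apply: le_anti; rewrite xi_AB.
Qed.

HB.instance Definition _ := Order.Le_isPOrder.Build d contraction
  contraction_ord_refl contraction_ord_anti contraction_ord_trans.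

Lemma contraction_leE (A B : contraction) :
  (A <= B) = contraction_le (val A) (val B).
Proof. by []. Qed.

Definition contract (x : P) : contraction :=
  exist _ (root (level_step xi0) x) (roots_root (level_connect_sym xi0) x).

Lemma level_contract x : level_connect xi0 x (val (contract x)).
Proof. exact: connect_root. Qed.

Lemma contract_eq x y : (contract x == contract y) = level_connect xi0 x y.
Proof. by rewrite -val_eqE /= (root_connect (level_connect_sym xi0)). Qed.

Lemma valK_contract : cancel val contract.
Proof.
move=> A; apply/contraction_ext.
by rewrite /level_connect (level_connect_sym xi0); apply: level_contract.
Qed.

Lemma contract_mono : {homo contract : x y / x <= y}.
Proof.
move=> x y le_xy; rewrite contraction_leE.
apply: connect_trans (level_contraction_le (level_contract y)).
apply: connect_trans (le_contraction_le le_xy).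
by apply: level_contraction_le; rewrite /level_connect level_connect_sym;
   apply: level_contract.
Qed.

(** The bijection is composition with [contract].  A strict map on the
    contraction takes different values on different comparable pieces, so the
    composite has precisely these pieces; conversely a map with this partition
    factors through the contraction, by restricting it to the roots, and
    [contraction_le_mono] makes the factor strict. *)
Lemma card_strict_contraction (T : finPOrderType d) :
  #|strict_homs (contraction : finPOrderType d) T|
    = #|[set xi : hom P T | [forall x, G xi x == G xi0 x]]| :> nat.
Proof.
rewrite -(card_imset _ (precomp_inj (f_mono := contract_mono) valK_contract)).
congr #|pred_of_set _|; apply/setP=> xi; rewrite inE.
apply/imsetP/forallP=> [[zeta /strictP zeta_str ->] x|eqG].
  apply/eqP/setP=> y; rewrite !mem_G.
  apply/idP/idP; apply: {x y} connect_sub => x y /andP[/eqP val_xy cmp_xy].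
    rewrite -/(level_connect xi0 x y) -contract_eq; move: val_xy.
    rewrite !precompE; apply: contra_eqT => ne_xy; case/orP: cmp_xy => le.
      by rewrite lt_eqF // zeta_str // lt_neqAle ne_xy contract_mono.
    by rewrite gt_eqF // zeta_str // lt_neqAle eq_sym ne_xy contract_mono.
  apply: level_connect1 => //; rewrite !precompE.
  suff /eqP->: contract x == contract y by [].
  by rewrite contract_eq level_connect1.
have eq_lv : level_connect xi =2 level_connect xi0.
  by move=> x y; rewrite -!mem_G (eqP (eqG x)).
have val_mono : {homo (fun A : contraction => val xi (val A)) : A B / A <= B}.
  by move=> A B le_AB; have [] := contraction_le_mono eq_lv le_AB.
exists (mk_hom val_mono); last first.
  apply: hom_ext => x; rewrite precompE mk_homE.
  by apply: level_connect_val; rewrite eq_lv level_contract.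
apply/strictP=> A B; rewrite lt_neqAle => /andP[ne_AB le_AB].
rewrite !mk_homE lt_neqAle val_mono // andbT.
apply: contra ne_AB => /eqP eq_AB; apply/eqP/contraction_ext.
by have [_ ->] := contraction_le_mono eq_lv le_AB.
Qed.

End Contraction.

(** * Partition-preserving injections *)

(** Sort the homomorphisms by their partition and inject class by class. A
    homomorphism to [R] with a given partition provides a contraction, whose
    strict homomorphisms to [R] and to [S] are as many as the homomorphisms in
    the corresponding classes; if there is none, the class is empty on the
    side of [R]. The result is an element of a finite type, specified by a
    boolean property, so that an actual witness can be extracted for all
    members of a family of posets without the axiom of choice. *)
Lemma G_preserving_injection (d : Order.disp_t) (R S P : finPOrderType d) :
    (forall Q : finPOrderType d, #|strict_homs Q R| <= #|strict_homs Q S|)%N ->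
  {rho : {ffun hom P R -> hom P S} |
    injectiveb rho && [forall xi, forall x, G (rho xi) x == G xi x]}.
Proof.
move=> le_RS; apply: sigW.
pose profile (T : finPOrderType d) (xi : hom P T) := [ffun x => G xi x].
have profileE T U (xi : hom P T) (eta : hom P U) :
    (profile T xi == profile U eta) = [forall x, G xi x == G eta x].
  by apply/eqP/forallP=> [/ffunP eqG x|eqG]; [|apply/ffunP=> x];
     have := eqG x; rewrite !ffunE => /eqP.
have [k|h [h_inj hG]] := @fibrewise_injection _ _ _ (profile R) (profile S).
  have [->|[xi0]] := set_0Vmem [set xi | profile R xi == k].
    by rewrite cards0.
  rewrite inE => /eqP <-.
  under eq_finset do rewrite profileE.
  under [X in (_ <= #|pred_of_set X|)%N]eq_finset do rewrite profileE.
  by rewrite -!card_strict_contraction.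
exists (finfun h); apply/andP; split.
  by apply/injectiveP=> x y; rewrite !ffunE; apply: h_inj.
by apply/forallP=> xi; rewrite ffunE -profileE hG.
Qed.

Lemma card_strict_homs_G_preserving (d : Order.disp_t) (R S P : finPOrderType d)
    (rho : hom P R -> hom P S) :
    injective rho -> (forall xi x, G (rho xi) x = G xi x) ->
  (#|strict_homs P R| <= #|strict_homs P S|)%N.
Proof.
move=> rho_inj rhoG; rewrite -(card_imset _ rho_inj).
apply/subset_leq_card/subsetP=> _ /imsetP[xi /strict_GP xi_str ->].
by apply/strict_GP=> x; rewrite rhoG.
Qed.

(** * Disjoint unions and connected components *)

Section Subposets.
Variables (d : Order.disp_t) (P : finPOrderType d) (A : {set P}).

Definition subposet := {x : P | x \in A}.

HB.instance Definition _ := SubFinite.on subposet.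
HB.instance Definition _ := [SubChoice_isSubPOrder of subposet by <: with d].

Lemma card_subposet : #|{: subposet}| = #|A| :> nat.
Proof. by rewrite card_sig; apply: eq_card => x; rewrite inE. Qed.

Lemma subposet_val_mono : {homo (val : subposet -> P) : x y / x <= y}.
Proof. exact: le_wval. Qed.

Lemma subposet_ex x : x \in A -> exists u : subposet, x = val u.
Proof. by move=> Ax; exists (exist _ x Ax). Qed.

Definition restrict (T : finPOrderType d) : hom P T -> hom subposet T :=
  precomp subposet_val_mono.

Lemma restrictE (T : finPOrderType d) (xi : hom P T) u :
  val (restrict xi) u = val xi (val u).
Proof. exact: precompE. Qed.

Lemma restrict_strict (T : finPOrderType d) (xi : hom P T) :
  xi \in strict_homs P T ->
  restrict xi \in strict_homs (subposet : finPOrderType d) T.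
Proof.
by move/strictP=> str; apply/strictP=> u v; rewrite -lt_val !restrictE => /str.
Qed.

End Subposets.

Section Splitting.
Variables (d : Order.disp_t) (P T : finPOrderType d) (A : {set P}).

(** The proof of membership has to be at hand to apply [f] or [g], hence the
    match on a decision instead of a boolean test. *)
Definition glue (f : subposet A -> T) (g : subposet (~: A) -> T) (x : P) : T :=
  match decP (@idP (x \in A)) with
  | left Ax => f (exist _ x Ax)
  | right nAx => g (exist _ x (introT setCP nAx))
  end.

Lemma glue_in f g u : glue f g (val u) = f u.
Proof.
rewrite /glue; case: decP => [Au|[]]; last exact: svalP u.
by congr f; apply: val_inj.
Qed.

Lemma glue_out f g u : glue f g (val u) = g u.
Proof.
rewrite /glue; case: decP => [Au|nAu]; first by case/setCP: (svalP u).
by congr g; apply: val_inj.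
Qed.

(** [A] and its complement are unions of components, so no order relation
    links them. *)
Hypothesis A_closed : forall x y : P, x <= y -> (x \in A) = (y \in A).

Lemma card_strict_homs_split :
  (#|strict_homs P T| =
   #|strict_homs (subposet A : finPOrderType d) T| *
   #|strict_homs (subposet (~: A) : finPOrderType d) T|)%N.
Proof.
pose split_hom (xi : hom P T) := (restrict A xi, restrict (~: A) xi).
have split_inj : injective split_hom.
  move=> xi eta eq_split; apply: hom_ext => x.
  have eq_in : restrict A xi = restrict A eta := congr1 fst eq_split.
  have eq_out : restrict (~: A) xi = restrict (~: A) eta := congr1 snd eq_split.
  case: (boolP (x \in A)) => [|]; last rewrite -in_setC;
    by move=> /subposet_ex[u ->]; rewrite -!restrictE ?eq_in ?eq_out.
rewrite -(card_imset _ split_inj).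
rewrite -(cardsX (strict_homs _ _) (strict_homs _ _)); congr #|pred_of_set _|.
apply/setP=> -[eta zeta]; rewrite in_setX.
apply/imsetP/andP=> [[xi xi_str [-> ->]]|[/strictP eta_str /strictP zeta_str]].
  by rewrite !restrict_strict.
have glue_lt : {homo glue (val eta) (val zeta) : x y / x < y}.
  move=> x y lt_xy; have := A_closed (ltW lt_xy).
  case: (boolP (x \in A)) => [Ax /esym Ay|].
    case/subposet_ex: Ax lt_xy => u ->; case/subposet_ex: Ay => v ->.
    by rewrite !glue_in lt_val => /eta_str.
  rewrite -in_setC => nAx /esym/negbT; rewrite -in_setC => nAy.
  case/subposet_ex: nAx lt_xy => u ->; case/subposet_ex: nAy => v ->.
  by rewrite !glue_out lt_val => /zeta_str.
exists (mk_hom (ltW_homo glue_lt)).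
  by apply/strictP=> x y lt_xy; rewrite !mk_homE glue_lt.
congr pair; apply: hom_ext => u; rewrite restrictE mk_homE.
  by rewrite glue_in.
by rewrite glue_out.
Qed.

End Splitting.

Section Components.
Variables (d : Order.disp_t) (P : finPOrderType d) (x : P).

Definition component : {set P} := [set y | connect (>=<%O : rel P) x y].

Lemma component_self : x \in component.
Proof. by rewrite inE connect0. Qed.

Lemma component_closed y z : y <= z -> (y \in component) = (z \in component).
Proof.
move=> le_yz; rewrite !inE; apply: same_connect_r.
  by apply: sym_connect_sym => u v; apply: comparable_sym.
by apply: connect1; apply: le_comparable.
Qed.

(** A path of [P] that starts in the component stays in it, and so lifts to the
    subposet point by point. *)
Lemma component_connected :
  connected_poset (subposet component : finPOrderType d).
Proof.
case/subposet_ex: component_self => r def_x; exists r.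
apply/setP=> v; rewrite [RHS]inE /gamma !inE /=.
have: val v \in component by exact: svalP v.
rewrite inE => /connectP[p]; rewrite {1 2}def_x.
elim: p r {def_x} => [|z p IHp] u /=.
  by move=> _ /val_inj ->; apply: connect0.
case/andP=> cmp_uz e_p def_v.
have: z \in component.
  have := svalP u; rewrite -/(val u).
  by case/orP: cmp_uz => /component_closed ->.
case/subposet_ex => w def_z; rewrite def_z in cmp_uz e_p def_v.
apply: connect_trans (IHp w e_p def_v).
have [->|ne_uw] := eqVneq u w; first exact: connect0.
apply: connect1; rewrite /step_in /= !inE /= !lt_neqAle ne_uw eq_sym ne_uw.
by rewrite -!Order.le_val.
Qed.

End Components.

Lemma card_strict_homs_empty (d : Order.disp_t) (P T : finPOrderType d) :
  #|{: P}| = 0%N -> #|strict_homs P T| = 1%N.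
Proof.
move/card0_eq=> P0; have no_x (x : P) : False by have := P0 x.
have f_mono : {homo (fun x => match no_x x return T with end) : x y / x <= y}.
  by move=> x; have := no_x x.
rewrite -(cards1 (mk_hom f_mono)); congr #|pred_of_set _|; apply/setP=> xi.
rewrite in_set1.
have -> : xi = mk_hom f_mono by apply: hom_ext => x; have [] := no_x x.
by rewrite eqxx; apply/strictP=> x; have [] := no_x x.
Qed.

(** Induction on the number of points, splitting off the component of one
    point.  The empty poset starts the induction: it is not connected, and has
    exactly one strict homomorphism into any poset. *)
Lemma card_strict_homs_connected (d : Order.disp_t) (R S : finPOrderType d) :
    (forall Q : finPOrderType d, connected_poset Q ->
       #|strict_homs Q R| <= #|strict_homs Q S|)%N ->
  forall P : finPOrderType d, (#|strict_homs P R| <= #|strict_homs P S|)%N.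
Proof.
move=> le_conn P; have [n] := ubnP #|{: P}|; elim: n P => // n IHn P lt_Pn.
have [P0|/card_gt0P[x _]] := posnP #|{: P}|.
  by rewrite !card_strict_homs_empty.
rewrite !(card_strict_homs_split _ (@component_closed _ P x)).
apply: leq_mul; first exact/le_conn/component_connected.
apply: IHn; rewrite card_subposet -ltnS.
apply: leq_trans lt_Pn; rewrite ltnS.
rewrite -(cardsC (component x)) -[ltnLHS]add0n ltn_add2r.
by apply/card_gt0P; exists x; apply: component_self.
Qed.

(** * The equivalence *)

Local Close Scope order_scope.

Theorem theorem1 (d : Order.disp_t) (I : Type) (Pr : I -> finPOrderType d)
    (hPr : representation_system Pr) (R S : finPOrderType d) :
  (sqsubseteq_G Pr R S <->
    (forall P : finPOrderType d, #|strict_homs P R| <= #|strict_homs P S|)) /\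
  ((forall P : finPOrderType d, #|strict_homs P R| <= #|strict_homs P S|) <->
    (forall Q : finPOrderType d, connected_poset Q ->
      #|strict_homs Q R| <= #|strict_homs Q S|)).
Proof.
split; split.
- case=> rho [rho_inj rhoG] P; have [i [iso_Pi _]] := hPr P.
  rewrite !(card_strict_homs_iso _ iso_Pi).
  exact: card_strict_homs_G_preserving (rho_inj i) (rhoG i).
- move=> le_RS; exists (fun i => sval (G_preserving_injection (Pr i) le_RS)).
  split=> i; have /andP[inj eqG] := svalP (G_preserving_injection (Pr i) le_RS).
    exact/injectiveP.
  by move=> xi x; apply/eqP; move/forallP: eqG => /(_ xi)/forallP.
- by move=> le_RS Q _.
- exact: card_strict_homs_connected.
Qed.
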